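(* Let $\alpha>0$, let $\mathbf{A}_{11}\in\mathbb{R}^{n_1\times n_1}$ be stable, and let $\mathbf{A}(\alpha),\mathbf{H}(\alpha),\mathbf{N},\mathbf{B},\mathbf{C}$ be the matrices of an artificially stabilized lifted quadratic-bilinear system (see context), with block structure $$\mathbf{A}(\alpha)=\begin{bmatrix}\mathbf{A}_{11}&\mathbf{A}_{12}\\ \mathbf{0}&-\alpha\mathbf{I}\end{bmatrix},\quad \mathbf{H}(\alpha)=\begin{bmatrix}\mathbf{0}\\ \mathbf{H}_2(\alpha)\end{bmatrix},\quad \mathbf{N}=\begin{bmatrix}\mathbf{0}&\mathbf{0}\\ \mathbf{N}_{21}&\mathbf{N}_{22}\end{bmatrix},\quad \mathbf{B}=\begin{bmatrix}\mathbf{B}_1\\ \mathbf{0}\end{bmatrix},\quad \mathbf{C}=\begin{bmatrix}\mathbf{C}_1&\mathbf{0}\end{bmatrix}.$$ Let $\mathbf{P}_1$ be the solution of $\mathbf{A}(\alpha)\mathbf{P}_1+\mathbf{P}_1\mathbf{A}(\alpha)^\top+\mathbf{B}\mathbf{B}^\top=\mathbf{0}$, and let $$\mathbf{Q}_1=\begin{bmatrix}\mathbf{Q}_{11}&\mathbf{Q}_{12}(\alpha)\\ \mathbf{Q}_{12}(\alpha)^\top&\frac{1}{2\alpha}\widetilde{\mathbf{Q}}_{22}(\alpha)\end{bmatrix}$$ be the solution of $\mathbf{A}(\alpha)^\top\mathbf{Q}_1+\mathbf{Q}_1\mathbf{A}(\alpha)+\mathbf{C}^\top\mathbf{C}=\mathbf{0}$,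 where $\mathbf{A}_{11}^\top\mathbf{Q}_{11}+\mathbf{Q}_{11}\mathbf{A}_{11}+\mathbf{C}_1^\top\mathbf{C}_1=\mathbf{0}$, $\mathbf{Q}_{12}(\alpha)=-(\mathbf{A}_{11}^\top-\alpha\mathbf{I})^{-1}\mathbf{Q}_{11}\mathbf{A}_{12}$ and $\widetilde{\mathbf{Q}}_{22}(\alpha)=\mathbf{A}_{12}^\top\mathbf{Q}_{12}(\alpha)+\mathbf{Q}_{12}(\alpha)^\top\mathbf{A}_{12}$. Partition $$\mathcal{H}^{(2)}(\alpha)(\mathbf{P}_1\otimes\mathbf{Q}_1)(\mathcal{H}^{(2)}(\alpha))^\top=:\begin{bmatrix}\widetilde{\mathbf{H}}_{11}(\alpha)&\widetilde{\mathbf{H}}_{12}(\alpha)\\ \widetilde{\mathbf{H}}_{12}(\alpha)^\top&\widetilde{\mathbf{H}}_{22}(\alpha)\end{bmatrix}$$ with blocks of sizes $n_1,n_2$. Then the truncated (observability) Gramian $\mathbf{Q}_{\mathcal{T}}$, i.e. the solution of $$\mathbf{A}(\alpha)^\top\mathbf{Q}_{\mathcal{T}}+\mathbf{Q}_{\mathcal{T}}\mathbf{A}(\alpha)+\mathcal{H}^{(2)}(\alpha)(\mathbf{P}_1\otimes\mathbf{Q}_1)(\mathcal{H}^{(2)}(\alpha))^\top+\mathbf{N}^\top\mathbf{Q}_1\mathbf{N}+\mathbf{C}^\top\mathbf{C}=\mathbf{0},$$ is given by $$\mathbf{Q}_{\mathcal{T}}=\mathbf{Q}_1+\begin{bmatrix}\widehat{\mathbf{Q}}_{11}(\alpha)&\widehat{\mathbf{Q}}_{12}(\alpha)\\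 \widehat{\mathbf{Q}}_{12}(\alpha)^\top&\widehat{\mathbf{Q}}_{22}(\alpha)\end{bmatrix},$$ where $\widehat{\mathbf{Q}}_{11}(\alpha)$ is the solution of $$\mathbf{A}_{11}^\top\widehat{\mathbf{Q}}_{11}(\alpha)+\widehat{\mathbf{Q}}_{11}(\alpha)\mathbf{A}_{11}+\widetilde{\mathbf{H}}_{11}(\alpha)+\frac{1}{2\alpha}\mathbf{N}_{21}^\top\widetilde{\mathbf{Q}}_{22}(\alpha)\mathbf{N}_{21}=\mathbf{0},$$ and $$\widehat{\mathbf{Q}}_{12}(\alpha)=-(\mathbf{A}_{11}^\top-\alpha\mathbf{I})^{-1}\left(\widetilde{\mathbf{H}}_{12}(\alpha)+\frac{1}{2\alpha}\mathbf{N}_{21}^\top\widetilde{\mathbf{Q}}_{22}(\alpha)\mathbf{N}_{22}+\widehat{\mathbf{Q}}_{11}(\alpha)\mathbf{A}_{12}\right),$$ $$\widehat{\mathbf{Q}}_{22}(\alpha)=\frac{1}{2\alpha}\left[\mathbf{A}_{12}^\top\widehat{\mathbf{Q}}_{12}(\alpha)+\widehat{\mathbf{Q}}_{12}(\alpha)^\top\mathbf{A}_{12}+\widetilde{\mathbf{H}}_{22}(\alpha)+\frac{1}{2\alpha}\mathbf{N}_{22}^\top\widetilde{\mathbf{Q}}_{22}(\alpha)\mathbf{N}_{22}\right].$$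
   Context: A real square matrix is called stable if all its eigenvalues have strictly negative real part; for a stable coefficient matrix the Lyapunov equations involved have unique solutions. $\otimes$ is the Kronecker product and $\mathbf{I}$ an identity matrix of appropriate size. Lifted quadratic-bilinear system: the state is $\mathbf{x}=[\mathbf{x}_1^\top,\mathbf{w}^\top]^\top\in\mathbb{R}^{n_1+n_2}$, where $\mathbf{x}_1\in\mathbb{R}^{n_1}$ is the original state and $\mathbf{w}\in\mathbb{R}^{n_2}$ collects the auxiliary (lifting) variables, given by a map $\mathbf{w}=\tau(\mathbf{x}_1)$. With $N=n_1+n_2$, the lifted dynamics have a linear term with matrix $\begin{bmatrix}\mathbf{A}_{11}&\mathbf{A}_{12}\\ \mathbf{0}&\mathbf{0}\end{bmatrix}$, a quadratic term $\mathbf{H}(\mathbf{x}\otimes\mathbf{x})$ with $\mathbf{H}\in\mathbb{R}^{N\times N^2}$ whose first $n_1$ rows are zero, a bilinear term with matrix $\mathbf{N}\in\mathbb{R}^{N\times N}$, an input term with matrix $\mathbf{B}\in\mathbb{R}^{N\times m}$, and output $\mathbf{y}=\mathbf{C}\mathbf{x}$ with $\mathbf{C}\in\mathbb{R}^{p\times N}$ ($\mathbf{N}_{21}\in\mathbb{R}^{n_2\times n_1}$, $\mathbf{N}_{22}\in\mathbb{R}^{n_2\times n_2}$, $\mathbf{A}_{12}\in\mathbb{R}^{n_1\times n_2}$, $\mathbf{B}_1\in\mathbb{R}^{n_1\times m}$, $\mathbf{C}_1\in\mathbb{R}^{p\times n_1}$). The artificial stabilization replaces the linear matrix by $\mathbf{A}(\alpha)$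 and $\mathbf{H}$ by $\mathbf{H}(\alpha)=\mathbf{H}+\widetilde{\mathbf{H}}(\alpha)$, where $\widetilde{\mathbf{H}}(\alpha)\in\mathbb{R}^{N\times N^2}$ (not to be confused with the blocks $\widetilde{\mathbf{H}}_{ij}(\alpha)$ in the claim) has its first $n_1$ rows zero and satisfies $-\alpha[\mathbf{0}^\top,\mathbf{w}^\top]^\top+\widetilde{\mathbf{H}}(\alpha)(\mathbf{x}\otimes\mathbf{x})=\mathbf{0}$ for all lifted states $\mathbf{x}=[\mathbf{x}_1^\top,\mathbf{w}^\top]^\top$ with $\mathbf{w}=\tau(\mathbf{x}_1)$. As a convention, $\mathbf{H}(\alpha)$ is symmetric in the sense $\mathbf{H}(\alpha)(\mathbf{a}\otimes\mathbf{b})=\mathbf{H}(\alpha)(\mathbf{b}\otimes\mathbf{a})$ for all $\mathbf{a},\mathbf{b}\in\mathbb{R}^N$. Matricizations: $\mathbf{H}(\alpha)$ is the mode-1 matricization of a tensor $\mathcal{H}(\alpha)\in\mathbb{R}^{N\times N\times N}$, i.e. $\mathbf{H}(\alpha)_{i,(k-1)N+j}=\mathcal{H}(\alpha)_{ijk}$, and $\mathcal{H}^{(2)}(\alpha)\in\mathbb{R}^{N\times N^2}$ is its mode-2 matricization, $\mathcal{H}^{(2)}(\alpha)_{j,(k-1)N+i}=\mathcal{H}(\alpha)_{ijk}$. *)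

(* Defs.v *)
From mathcomp Require Import all_boot all_order all_algebra.
From mathcomp Require Export complex mxtens.
From mathcomp Require Export reals.

Set Implicit Arguments.
Unset Strict Implicit.
Unset Printing Implicit Defensive.

Import Order.TTheory GRing.Theory Num.Theory.
Local Open Scope ring_scope.

Definition stable (R : realType) (n : nat) (A : 'M[R]_n) : Prop :=
  forall z : R[i], eigenvalue (map_mx (real_complex R) A) z -> complex.Re z < 0.

(* The 1-based column index (k-1)N + j is, 0-based, k * N + j, which is the
   value of [mxtens_index (k, j)].  This is also the index convention of the
   Kronecker product [*t]. *)
Definition mode1 (R : realType) (N : nat) (T : 'I_N -> 'I_N -> 'I_N -> R) :
    'M[R]_(N, N * N) :=
  \matrix_(i, c) T i (mxtens_unindex c).2 (mxtens_unindex c).1.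

Definition mode2 (R : realType) (N : nat) (T : 'I_N -> 'I_N -> 'I_N -> R) :
    'M[R]_(N, N * N) :=
  \matrix_(j, c) T (mxtens_unindex c).2 j (mxtens_unindex c).1.

Definition symmetric_quadratic (R : realType) (N : nat)
    (H : 'M[R]_(N, N * N)) : Prop :=
  forall a b : 'cV[R]_N, H *m (a *t b) = H *m (b *t a).

Definition lifted_state (R : realType) (n1 n2 : nat)
    (tau : 'cV[R]_n1 -> 'cV[R]_n2) (x1 : 'cV[R]_n1) : 'cV[R]_(n1 + n2) :=
  col_mx x1 (tau x1).

(* [H] is the quadratic term of the lifted system, [Htil] the correction that
   cancels, on lifted states, the term - alpha w added to the linear part, and
   [Halpha] the quadratic term of the artificially stabilized system. *)
Record stabilized_quadratic (R : realType) (n1 n2 : nat) (alpha : R)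
    (tau : 'cV[R]_n1 -> 'cV[R]_n2)
    (H Htil Halpha : 'M[R]_(n1 + n2, (n1 + n2) * (n1 + n2))) : Prop :=
  StabilizedQuadratic {
    stabilized_top : usubmx H = 0;
    stabilized_corr_top : usubmx Htil = 0;
    stabilized_cancel : forall x1 : 'cV[R]_n1,
      let x := lifted_state tau x1 in
      - (alpha *: col_mx 0 (tau x1)) + Htil *m (x *t x) = 0;
    stabilized_sum : Halpha = H + Htil;
    stabilized_sym : symmetric_quadratic Halpha
  }.

(* Main.v *)
(* If [A X = X B], then [Y = X p(B)] also satisfies [A Y = Y B] for every
   polynomial [p], so [Y (B - z) = (A - z) Y], and [Y (B - z) = 0] forces [Y = 0]
   unless [z] is an eigenvalue of [A].  Since [X chi_B(B) = 0] by Cayley-Hamilton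
   and [chi_B] splits over R[i], peeling off its roots gives [X = 0] when [A] and
   [B] share no eigenvalue.  For stable matrices this is uniqueness in Lyapunov
   equations, hence symmetry of [P1], [Q1], [Qhat11] and [M]; the rest is a
   comparison of blocks, where [A11^T - alpha I] is invertible by stability. *)
Require Import Defs.
From mathcomp Require Import all_boot all_order all_algebra.
Import Order.TTheory GRing.Theory Num.Theory.
Local Open Scope ring_scope.

Lemma eigenvalue_unitmx (F : fieldType) (n : nat) (A : 'M[F]_n) (z : F) :
  eigenvalue A z = (A - z%:M \notin unitmx).
Proof. by rewrite -row_free_unit -kermx_eq0. Qed.

Lemma eigenvalue_trmx (F : fieldType) (n : nat) (A : 'M[F]_n) (z : F) :
  eigenvalue A^T z = eigenvalue A z.
Proof.
by rewrite !eigenvalue_unitmx -[in A^T - _]tr_scalar_mx -linearB unitmx_tr.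
Qed.

(** The induction on [s] keeps [X] general: its hypothesis is applied to [X *m (B - z%:M)],
    rewritten as [(A - z%:M) *m X], which again intertwines [A] and [B]. Invertibility of [A - z%:M]
    then brings the conclusion back to [X]. *)
Lemma sylvester_prod_eq0 (F : fieldType) (m n : nat) (A : 'M[F]_m)
    (B : 'M[F]_n.+1) (s : seq F) (X : 'M[F]_(m, n.+1)) :
  {in s, forall z, ~~ eigenvalue A z} -> A *m X = X *m B ->
  X *m \prod_(z <- s) (B - z%:M) = 0 -> X = 0.
Proof.
elim: s X => [|z s IHs] X sA AX; first by rewrite big_nil mulmx1.
have sA' : {in s, forall z, ~~ eigenvalue A z}.
  by move=> y ys; apply: sA; rewrite inE ys orbT.
have AzX : (A - z%:M) *m X = X *m (B - z%:M).
  by rewrite mulmxBl mulmxBr AX mul_scalar_mx mul_mx_scalar.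
rewrite big_cons -mulmxE mulmxA => /IHs; rewrite -AzX => /(_ sA').
have commA : A *m (A - z%:M) = (A - z%:M) *m A.
  by rewrite mulmxBl mulmxBr mul_scalar_mx mul_mx_scalar.
rewrite mulmxA commA -!mulmxA AX => /(_ erefl) AzX0.
have : A - z%:M \in unitmx.
  by rewrite -[_ \in _]negbK -eigenvalue_unitmx sA ?mem_head.
by move=> /mulKmx/(_ X) <-; rewrite AzX0 mulmx0.
Qed.

Lemma sylvester_eq0 (F : closedFieldType) (m n : nat) (A : 'M[F]_m)
    (B : 'M[F]_n) (X : 'M[F]_(m, n)) :
  (forall z, eigenvalue B z -> ~~ eigenvalue A z) -> A *m X = X *m B -> X = 0.
Proof.
case: n B X => [|n] B X AB AX; first by rewrite [X]thinmx0.
have [s Es] := closed_field_poly_normal (char_poly B).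
rewrite (monicP (char_poly_monic B)) scale1r in Es.
apply: (@sylvester_prod_eq0 _ _ _ A B s) => // [z zs|].
  by apply: AB; rewrite eigenvalue_root_char Es root_prod_XsubC.
have := Cayley_Hamilton B; rewrite Es rmorph_prod /=.
under eq_bigr do rewrite rmorphB /= horner_mx_X horner_mx_C.
by move->; rewrite mulmx0.
Qed.

Section Stable.
Variable R : realType.

Lemma stable_trmx (n : nat) (A : 'M[R]_n) : stable A -> stable A^T.
Proof. by move=> sA z; rewrite -map_trmx eigenvalue_trmx; exact: sA. Qed.

(** Over [R[i]], [X] intertwines [- A] and [B], whose spectra lie in opposite open half-planes and
    so are disjoint. *)
Lemma stable_sylvester_eq0 (m n : nat) (A : 'M[R]_m) (B : 'M[R]_n)
    (X : 'M[R]_(m, n)) :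
  stable A -> stable B -> A *m X + X *m B = 0 -> X = 0.
Proof.
move=> sA sB AXB; apply: (map_mx_inj (f := real_complex R)).
rewrite map_mx0.
apply: (@sylvester_eq0 R[i] _ _ (- map_mx (real_complex R) A)
  (map_mx (real_complex R) B)) => [z /sB Bz|]; last first.
  rewrite -map_mxM mulNmx -map_mxM -map_mxN; congr map_mx.
  by apply/eqP; rewrite eqr_oppLR -addr_eq0 AXB.
(* If [z] were an eigenvalue of [- A], then [- z] would be one of [A], and both [z] and [- z] would
   have negative real part. *)
apply/negP; rewrite eigenvalue_unitmx -opprD -scaleN1r unitmxZ ?unitrN1 //.
rewrite -[z]opprK rmorphN /= -eigenvalue_unitmx => /sA.
by rewrite raddfN /= oppr_lt0 ltNge ltW.
Qed.

(** Transposing the equation shows that [X^T] solves it too, so [X^T - X] solves the homogeneous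
    equation and vanishes. *)
Lemma lyapunov_sym (n : nat) (A S X : 'M[R]_n) :
  stable A -> S^T = S -> A *m X + X *m A^T + S = 0 -> X^T = X.
Proof.
move=> sA symS AX; apply/eqP; rewrite -subr_eq0; apply/eqP.
apply: (stable_sylvester_eq0 _ _ _ _ _ sA (stable_trmx _ _ sA)).
have AXt : A *m X^T + X^T *m A^T + S = 0.
  rewrite -[RHS](trmx0 R n n) -AX !linearD /= !trmx_mul trmxK symS.
  by rewrite [X in X + _]addrC.
rewrite mulmxBr mulmxBl addrACA -opprD -[RHS](subrr 0).
by rewrite -[X in _ = X - _]AXt -[X in _ = _ - X]AX
  [in RHS]opprD [RHS]addrACA subrr addr0.
Qed.

(** Otherwise the positive number [a] would be a root of the characteristic polynomial, hence also
    an eigenvalue over [R[i]]. *)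
Lemma stable_sub_scalar_unitmx (n : nat) (A : 'M[R]_n) (a : R) :
  0 < a -> stable A -> A - a%:M \in unitmx.
Proof.
move=> a_gt0 sA; rewrite -[_ \in _]negbK -eigenvalue_unitmx; apply/negP => Aa.
suff /sA /= : eigenvalue (map_mx (real_complex R) A) (real_complex R a).
  by rewrite ltNge ltW.
by move: Aa; rewrite !eigenvalue_root_char -map_char_poly fmorph_root.
Qed.

(** Eigenvectors are rows here: the first block of a row eigenvector is an eigenvector of [A11]
    unless it is zero, and then the second block forces the eigenvalue to be [- a]. *)
Lemma stable_ublock_mx (n1 n2 : nat) (A11 : 'M[R]_n1) (A12 : 'M[R]_(n1, n2))
    (a : R) :
  0 < a -> stable A11 -> stable (block_mx A11 A12 0 (- a%:M)).
Proof.
move=> a_gt0 sA z /eigenvalueP[v].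
rewrite -[v]hsubmxK; set v1 := lsubmx v; set v2 := rsubmx v.
rewrite map_block_mx map_mx0 map_mxN map_scalar_mx mul_row_block scale_row_mx.
move=> /eq_row_mx[]; rewrite mulmx0 addr0 => v1z v2z v_neq0.
have [v10|v1_neq0] := eqVneq v1 0; last by apply: sA; apply/eigenvalueP; exists v1.
move: v_neq0 v2z; rewrite v10 mul0mx add0r mulmxN mul_mx_scalar -scaleNr.
have [->|v2_neq0 _ /eqP] := eqVneq v2 0; first by rewrite row_mx0 eqxx.
rewrite -subr_eq0 -scalerBl scaler_eq0 (negPf v2_neq0) orbF subr_eq0.
by move=> /eqP <-; rewrite raddfN /= oppr_lt0.
Qed.

(** This serves both for [Q1] and for the correction [QT - Q1]. The formulas solve the equation
    block by block, from [X11] to [X12] to [X22]; stability of [A] leaves no other solution. *)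
Lemma lyapunov_block (n1 n2 : nat) (a : R) (A11 : 'M[R]_n1)
    (A12 : 'M[R]_(n1, n2)) (S11 X11 : 'M[R]_n1) (S12 X12 : 'M[R]_(n1, n2))
    (S22 X22 : 'M[R]_n2) (X : 'M[R]_(n1 + n2))
    (A := block_mx A11 A12 0 (- a%:M)) :
  0 < a -> stable A11 -> S11^T = S11 ->
  A11^T *m X11 + X11 *m A11 + S11 = 0 ->
  X12 = - (invmx (A11^T - a%:M) *m (S12 + X11 *m A12)) ->
  X22 = (2 * a)^-1 *: (A12^T *m X12 + X12^T *m A12 + S22) ->
  A^T *m X + X *m A + block_mx S11 S12 S12^T S22 = 0 <->
  X = block_mx X11 X12 X12^T X22.
Proof.
move=> a_gt0 sA symS X11E X12E X22E.
(* Symmetry of [X11] makes the lower left block equation the transpose of the upper right one. *)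
have symX : X11^T = X11.
  by apply: (lyapunov_sym _ A11^T S11 _ (stable_trmx _ _ sA)); rewrite ?trmxK.
have {}X12E : A11^T *m X12 + (X11 *m A12 - a *: X12) + S12 = 0.
  have /mulKVmx/(_ (S12 + X11 *m A12)) :=
    stable_sub_scalar_unitmx _ _ _ a_gt0 (stable_trmx _ _ sA).
  move/eqP; rewrite -[invmx _ *m _]opprK -X12E mulmxN mulmxBl mul_scalar_mx.
  rewrite eqr_oppLR => /eqP E.
  by rewrite addrCA E addrAC [_ + S12]addrC subrr.
(* The two copies of [- a%:M] contribute [2 * a] times [X22], which the factor in [X22E] cancels. *)
have X22E' : A12^T *m X12 - a *: X22 + (X12^T *m A12 - a *: X22) + S22 = 0.
  rewrite addrACA -opprD -scalerDl -mulr2n -mulr_natl X22E scalerA divff.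
    by rewrite scale1r [LHS]addrAC subrr.
  by rewrite mulf_neq0 ?pnatr_eq0 ?gt_eqF.
have X21E : A12^T *m X11 - a *: X12^T + X12^T *m A11 + S12^T = 0.
  rewrite -[RHS](trmx0 R n1 n2) -X12E !linearD /=.
  rewrite [(- (a *: X12))^T]linearN /= [(a *: X12)^T]linearZ /=.
  by rewrite !trmx_mul trmxK symX [X in X + S12^T]addrC.
have AX0 : A^T *m block_mx X11 X12 X12^T X22 + block_mx X11 X12 X12^T X22 *m A
    + block_mx S11 S12 S12^T S22 = 0.
  rewrite /A tr_block_mx trmx0 linearN /= tr_scalar_mx !mulmx_block.
  rewrite !mulmx0 !mul0mx !addr0 !mulNmx !mulmxN !mul_scalar_mx !mul_mx_scalar.
  rewrite !add_block_mx X11E X12E X21E X22E' -[RHS]submxK.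
  by rewrite /ulsubmx /ursubmx /dlsubmx /drsubmx !linear0.
split=> [AX|->//]; apply/eqP; rewrite -subr_eq0; apply/eqP.
have sAA : stable A by exact: stable_ublock_mx.
apply: (stable_sylvester_eq0 _ _ _ _ _ (stable_trmx _ _ sAA) sAA).
rewrite mulmxBr mulmxBl addrACA -opprD -[RHS](subrr 0).
by rewrite -[X in _ = X - _]AX -[X in _ = _ - X]AX0
  [in RHS]opprD [RHS]addrACA subrr addr0.
Qed.

End Stable.

Theorem proposition5 (R : realType) (n1 n2 m p : nat) (alpha : R)
  (alpha_gt0 : 0 < alpha)
  (A11 : 'M[R]_n1) (A12 : 'M[R]_(n1, n2))
  (N21 : 'M[R]_(n2, n1)) (N22 : 'M[R]_n2)
  (B1 : 'M[R]_(n1, m)) (C1 : 'M[R]_(p, n1))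
  (tau : 'cV[R]_n1 -> 'cV[R]_n2)
  (H0 Htil : 'M[R]_(n1 + n2, (n1 + n2) * (n1 + n2)))
  (H2 : 'M[R]_(n2, (n1 + n2) * (n1 + n2)))
  (A : 'M[R]_(n1 + n2)) (H : 'M[R]_(n1 + n2, (n1 + n2) * (n1 + n2)))
  (N : 'M[R]_(n1 + n2)) (B : 'M[R]_(n1 + n2, m)) (C : 'M[R]_(p, n1 + n2))
  (stableA11 : stable A11)
  (AE : A = block_mx A11 A12 0 (- alpha%:M))
  (stabH : stabilized_quadratic alpha tau H0 Htil H)
  (HE : H = col_mx 0 H2)
  (NE : N = block_mx 0 0 N21 N22)
  (BE : B = col_mx B1 0)
  (CE : C = row_mx C1 0)
  (T : 'I_(n1 + n2) -> 'I_(n1 + n2) -> 'I_(n1 + n2) -> R)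
  (TE : H = mode1 T)
  (P1 Q1 : 'M[R]_(n1 + n2))
  (P1E : A *m P1 + P1 *m A^T + B *m B^T = 0)
  (Q1E : A^T *m Q1 + Q1 *m A + C^T *m C = 0)
  (Q11 : 'M[R]_n1) (Q12 : 'M[R]_(n1, n2)) (Qtil22 : 'M[R]_n2)
  (Q11E : A11^T *m Q11 + Q11 *m A11 + C1^T *m C1 = 0)
  (Q12E : Q12 = - (invmx (A11^T - alpha%:M) *m Q11 *m A12))
  (Qtil22E : Qtil22 = A12^T *m Q12 + Q12^T *m A12)
  (M : 'M[R]_(n1 + n2))
  (ME : M = mode2 T *m (P1 *t Q1) *m (mode2 T)^T)
  (Htil11 : 'M[R]_n1) (Htil12 : 'M[R]_(n1, n2)) (Htil22 : 'M[R]_n2)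
  (Htil11E : Htil11 = ulsubmx M)
  (Htil12E : Htil12 = ursubmx M)
  (Htil22E : Htil22 = drsubmx M)
  (Qhat11 : 'M[R]_n1) (Qhat12 : 'M[R]_(n1, n2)) (Qhat22 : 'M[R]_n2)
  (Qhat11E : A11^T *m Qhat11 + Qhat11 *m A11 + Htil11
             + (2 * alpha)^-1 *: (N21^T *m Qtil22 *m N21) = 0)
  (Qhat12E : Qhat12 =
     - (invmx (A11^T - alpha%:M) *m
        (Htil12 + (2 * alpha)^-1 *: (N21^T *m Qtil22 *m N22)
         + Qhat11 *m A12)))
  (Qhat22E : Qhat22 =
     (2 * alpha)^-1 *:
        (A12^T *m Qhat12 + Qhat12^T *m A12 + Htil22
         + (2 * alpha)^-1 *: (N22^T *m Qtil22 *m N22))) :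
  [/\ Q1 = block_mx Q11 Q12 Q12^T ((2 * alpha)^-1 *: Qtil22),
      M = block_mx Htil11 Htil12 Htil12^T Htil22
    & forall QT : 'M[R]_(n1 + n2),
        A^T *m QT + QT *m A + M + N^T *m Q1 *m N + C^T *m C = 0 <->
        QT = Q1 + block_mx Qhat11 Qhat12 Qhat12^T Qhat22].
Proof.
have sA : stable A by rewrite AE; exact: stable_ublock_mx.
have symP1 : P1^T = P1.
  by apply: (lyapunov_sym _ _ _ _ _ sA _ P1E); rewrite trmx_mul trmxK.
have Q1b : Q1 = block_mx Q11 Q12 Q12^T ((2 * alpha)^-1 *: Qtil22).
  (* The block [0^T] is left as is to match the pattern [S12^T] of [lyapunov_block]. *)
  have CC : C^T *m C = block_mx (C1^T *m C1) 0 0^T 0.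
    by rewrite CE tr_row_mx mul_col_row !trmx0 !mulmx0 !mul0mx.
  move: Q1E; rewrite AE CC.
  apply: (proj1 (lyapunov_block R n1 n2 alpha A11 A12 _ Q11 0 Q12 0 _ Q1
                   alpha_gt0 stableA11 _ Q11E _ _)).
  - by rewrite trmx_mul trmxK.
  - by rewrite add0r mulmxA.
  - by rewrite addr0 -Qtil22E.
have symQ22 : Qtil22^T = Qtil22.
  by rewrite Qtil22E linearD /= !trmx_mul !trmxK addrC.
have symQ1 : Q1^T = Q1.
  apply: (lyapunov_sym _ _ A^T (C^T *m C) _ (stable_trmx _ _ _ sA)).
    by rewrite trmx_mul trmxK.
  by rewrite trmxK.
have symM : M^T = M.
  by rewrite ME !trmx_mul trmxK trmx_tens symP1 symQ1 mulmxA.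
have Mb : M = block_mx Htil11 Htil12 Htil12^T Htil22.
  by rewrite Htil11E Htil12E Htil22E trmx_ursub symM submxK.
split=> // QT.
pose S12 := Htil12 + (2 * alpha)^-1 *: (N21^T *m Qtil22 *m N22).
(* The zero top rows of [N] leave only the lower right block of [Q1]; its symmetry makes the
   off-diagonal blocks transposes of each other. *)
have NQN : M + N^T *m Q1 *m N =
    block_mx (Htil11 + (2 * alpha)^-1 *: (N21^T *m Qtil22 *m N21)) S12
      S12^T (Htil22 + (2 * alpha)^-1 *: (N22^T *m Qtil22 *m N22)).
  rewrite Mb NE Q1b tr_block_mx !trmx0 !mulmx_block !mul0mx !mulmx0 !add0r.
  rewrite add_block_mx -!scalemxAr -!scalemxAl /S12 linearD linearZ /=.
  by rewrite !trmx_mul trmxK symQ22 mulmxA.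
(* Subtracting the equation of [Q1] removes [C^T *m C] and leaves a Lyapunov equation for
   [QT - Q1]. *)
have shift : A^T *m QT + QT *m A + M + N^T *m Q1 *m N + C^T *m C =
    A^T *m (QT - Q1) + (QT - Q1) *m A + (M + N^T *m Q1 *m N).
  have /eqP := Q1E; rewrite addrC addr_eq0 => /eqP ->.
  rewrite mulmxBr mulmxBl [X in _ = X + _]addrACA -opprD.
  by rewrite [RHS]addrAC addrA.
rewrite shift NQN AE.
apply: (iff_trans (lyapunov_block R n1 n2 alpha A11 A12 _ Qhat11 _ Qhat12 _ Qhat22
                     (QT - Q1) alpha_gt0 stableA11 _ _ Qhat12E _)).
- rewrite linearD linearZ /= !trmx_mul trmxK symQ22 mulmxA.
  by rewrite Htil11E trmx_ulsub symM.
- by rewrite addrA.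
- by rewrite addrA.
by split=> [<-|->]; rewrite addrC ?subrK ?addKr.
Qed.
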